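(* Assume that the online robot knows the length $L$ of the barrier $[0,L]$. For any $\epsilon>0$ (sufficiently small), every online algorithm for restoring complete barrier coverage has competitive ratio at least $\frac54-\epsilon$.
   Context: Model. Sensors $s_1,\dots,s_n$ are at initial locations $x_1\le\cdots\le x_n$ on the barrier $[0,L]$. A sensor at position $x$ covers the closed interval $[x-r,x+r]$; all sensors have the same range $r>0$, and $2rn\ge L$. The sensors provide complete coverage if every point of $[0,L]$ is covered by some sensor. A mobile robot starts at position $0$ and moves along the segment. Whenever it is at the current position of a sensor it may pick that sensor up; it can carry any number of sensors simultaneously, and it may drop any carried sensor at its current position; there is no restriction on the number or direction of turns. Its trajectory is a sequence $[t_0=0,t_1,\dots,t_m]$ of points of the barrier with $t_i>t_{i-1}$ for odd $i$ and $t_i<t_{i-1}$ for even $i$, with length $\sum_{i=1}^m|t_i-t_{i-1}|$. The robot must finish with the sensors in positions providing complete coverage of $[0,L]$. Offline optimum. An optimal offline trajectory is a trajectory of minimum length among all trajectories achieving complete coverage for the given instance, with all initial sensor positions known in advance. Online algorithms. An online robot (here) knows $L$ and the sensor range $r$, but knows about sensors only in the part of the barrier it has already travelled: it discovers the presence or absence of a sensor at position $x$ only when reaching $x$. It can remember everything it has seen. Admissible instances. Only instances in which the point $L$ is initially uncovered are considered (so every valid trajectory has length at least $L-r$). Competitive ratio. The competitive ratio of an online algorithm is the supremum, over admissible instances (over all $L$, $r$, $n$ and sensor positions), of the length of the online robot's trajectory divided by the length of an optimal offline trajectory on the same instance. *)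

(* Defs.v *)
From mathcomp Require Import all_boot all_order all_algebra.
From mathcomp Require Import boolp classical_sets reals constructive_ereal ereal.
Set Implicit Arguments.
Unset Strict Implicit.
Unset Printing Implicit Defensive.
Import Order.TTheory GRing.Theory Num.Theory.
Local Open Scope classical_set_scope.
Local Open Scope ring_scope.

Section BarrierCoverage.
Variable R : realType.

(* Several sensors may share a location; sensor [i] is the one at the [i]-th
   location of the list. *)
Record instance := Instance {
  barrier : R;      (* the length L *)
  radius : R;       (* the common range r *)
  sites : seq R     (* the initial locations x_1 <= ... <= x_n *)
}.

Definition covered_at (r : R) (ps : seq R) (x : R) : bool :=
  has (fun y => y - r <= x <= y + r) ps.

Definition complete_coverage (L r : R) (ps : seq R) : Prop :=
  forall x : R, 0 <= x <= L -> covered_at r ps x.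

Record admissible (I : instance) : Prop := Admissible {
  barrier_gt0 : 0 < barrier I;
  radius_gt0 : 0 < radius I;
  sites_sorted : sorted <=%R (sites I);
  sites_in_barrier : forall x, x \in sites I -> 0 <= x <= barrier I;
  enough_sensors : barrier I <= 2 * radius I * (size (sites I))%:R;
  endpoint_uncovered : ~~ covered_at (radius I) (sites I) (barrier I)
}.

(* [Go y] is a straight move from the current position to [y].  Picking up or
   dropping in the middle of a straight move is expressed by splitting it. *)
Inductive action := Go of R | Pick of nat | Drop of nat.

Definition plan := seq action.

(* [locations c] lists the current location of each sensor, [None] standing for
   a sensor carried by the robot. *)
Record config := Config { robot : R; locations : seq (option R) }.

Definition initial (I : instance) : config :=
  Config 0 [seq Some x | x <- sites I].

(* [None] signals an illegal action.  An index that is out of range can be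
   neither picked up nor dropped. *)
Definition step (L : R) (c : config) (a : action) : option config :=
  match a with
  | Go y => if 0 <= y <= L then Some (Config y (locations c)) else None
  | Pick i =>
      if nth None (locations c) i == Some (robot c)
      then Some (Config (robot c) (set_nth None (locations c) i None))
      else None
  | Drop i =>
      if (i < size (locations c))%N && (nth None (locations c) i == None)
      then Some (Config (robot c)
                   (set_nth None (locations c) i (Some (robot c))))
      else None
  end.

Fixpoint exec (L : R) (c : config) (p : plan) : option config :=
  if p is a :: p' then
    if step L c a is Some c' then exec L c' p' else None
  else Some c.

(* A sensor that is still carried at the end covers nothing; dropping it is
   free. *)
Definition restores (I : instance) (p : plan) : Prop :=
  exists2 c, exec (barrier I) (initial I) p = Some c
    & complete_coverage (barrier I) (radius I) (pmap id (locations c)).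

Definition stops (p : plan) : seq R :=
  pmap (fun a => if a is Go y then Some y else None) p.

(* [turning a b ys]: the turning points, and the end point, of the path that
   has so far gone monotonically from [a] to [b] and then visits [ys].  Stops
   at which the robot does not turn back are removed. *)
Fixpoint turning (a b : R) (ys : seq R) : seq R :=
  if ys is y :: ys' then
    if 0 <= (b - a) * (y - b) then turning a y ys' else b :: turning b y ys'
  else if b == a then [::] else [:: b].

Definition trajectory (p : plan) : seq R := 0 :: turning 0 0 (stops p).

Definition path_length (t : seq R) : R :=
  \sum_(1 <= i < size t) `|t`_i - t`_i.-1|.

Definition travel (p : plan) : R := path_length (trajectory p).

Definition optimal_offline (I : instance) (p : plan) : Prop :=
  restores I p /\ forall q, restores I q -> travel p <= travel q.

(* The length of an optimal offline trajectory, as an infimum in order to be a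
   total function; [opt_length_optimal] identifies it with the minimum. *)
Definition opt_length (I : instance) : R :=
  inf [set travel p | p in [set p | restores I p]].

Definition leaves (M : R) (a : action) : bool :=
  if a is Go y then M < y else false.

(* What the robot does before it first goes beyond [M]. *)
Definition before (M : R) (p : plan) : plan := take (find (leaves M) p) p.

Definition seen (M : R) (I : instance) : seq R := [seq x <- sites I | x <= M].

(* A deterministic online algorithm is a non-anticipating map from instances to
   plans: on two instances with the same L and r whose sensors in [0, M] are
   the same, the robot behaves identically as long as it stays in [0, M], and
   it leaves [0, M] on both or on neither.  Neither the number of sensors nor
   the sensors beyond [M] can influence this behaviour. *)
Record online_algorithm (A : instance -> plan) : Prop := OnlineAlgorithm {
  online_restores : forall I, admissible I -> restores I (A I);
  online_causal : forall (I J : instance) (M : R),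
    admissible I -> admissible J ->
    barrier I = barrier J -> radius I = radius J -> 0 <= M ->
    seen M I = seen M J ->
    before M (A I) = before M (A J) /\
    has (leaves M) (A I) = has (leaves M) (A J)
}.

Definition competitive_ratio (A : instance -> plan) : \bar R :=
  ereal_sup [set (travel (A I) / opt_length I)%:E | I in [set I | admissible I]].

Lemma path_length_cons (a b : R) (t : seq R) :
  path_length (a :: b :: t) = `|b - a| + path_length (b :: t).
Proof.
rewrite /path_length /= big_ltn //; congr (_ + _).
by rewrite big_add1 /=; apply: eq_big_nat => -[|i].
Qed.

Lemma path_length_turning (a b : R) (ys : seq R) :
  path_length (a :: turning a b ys) = `|b - a| + path_length (b :: ys).
Proof.
have nil1 (x : R) : path_length [:: x] = 0 by rewrite /path_length big_geq.
elim: ys a b => [|y ys IH] a b /=.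
  case: eqVneq => [->|_]; first by rewrite subrr normr0 add0r.
  by rewrite path_length_cons.
case: ifPn => [h|_]; last by rewrite !path_length_cons IH.
rewrite IH path_length_cons addrA; congr (_ + _).
have -> : y - a = (b - a) + (y - b) by rewrite [RHS]addrC subrKA.
have [b0|b0|b0] := ltgtP (b - a) 0.
- have y0 : y - b <= 0 by rewrite -(nmulr_rge0 _ b0).
  have ba0 := ltW b0; rewrite (ler0_norm ba0) (ler0_norm y0) -opprD.
  by rewrite ler0_norm // -[leRHS]addr0 lerD.
- have y0 : 0 <= y - b by rewrite -(pmulr_rge0 _ b0).
  have ba0 := ltW b0; rewrite (ger0_norm ba0) (ger0_norm y0).
  by rewrite ger0_norm // addr_ge0.
- by rewrite b0 normr0 !add0r.
Qed.

Lemma travelE (p : plan) : travel p = path_length (0 :: stops p).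
Proof. by rewrite /travel path_length_turning subrr normr0 add0r. Qed.

Lemma turning_alternates (up : bool) (a b : R) (ys : seq R) (i : nat) :
  (if up then a < b else b < a) -> (i < size (turning a b ys))%N ->
  if up (+) odd i then (a :: turning a b ys)`_i < (turning a b ys)`_i
  else (turning a b ys)`_i < (a :: turning a b ys)`_i.
Proof.
elim: ys up a b i => [|y ys IH] up a b i ab /=.
  case: eqVneq ab => [->|_ ab]; first by rewrite ltxx; case: up.
  by case: i => [|//] _; rewrite /= addbF.
case: ifPn => [h|]; last first.
  rewrite -ltNge => h; case: i => [_|i]; first by rewrite /= addbF.
  rewrite ltnS /= addbN -addNb; apply: IH.
  case: up ab => ab /=.
    by move: h; rewrite pmulr_rlt0 ?subr_gt0 // subr_lt0.
  by move: h; rewrite nmulr_rlt0 ?subr_lt0 // subr_gt0.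
apply: IH; case: up ab => ab.
  by move: h; rewrite pmulr_rge0 ?subr_gt0 // subr_ge0; apply: lt_le_trans.
by move: h; rewrite nmulr_rge0 ?subr_lt0 // subr_le0 => /le_lt_trans; apply.
Qed.

Lemma exec_stops (L : R) (c c' : config) (p : plan) :
  exec L c p = Some c' -> {in stops p, forall y, 0 <= y <= L}.
Proof.
elim: p c => [|a p IH] c //=.
case E: (step L c a) => [d|] // /IH; case: a E => //= y.
by case: ifP => // yL _ Hp z; rewrite inE => /orP[/eqP->|/Hp].
Qed.

(* The trajectory of a legal plan is t_0 = 0, t_1, ..., t_m with
   t_i > t_(i-1) for odd i and t_i < t_(i-1) for even i > 0. *)
Lemma trajectory_alternates (L : R) (c c' : config) (p : plan) (i : nat) :
  exec L c p = Some c' -> (0 < i < size (trajectory p))%N ->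
  if odd i then (trajectory p)`_i.-1 < (trajectory p)`_i
  else (trajectory p)`_i < (trajectory p)`_i.-1.
Proof.
move=> /exec_stops; rewrite /trajectory; case: i => // i.
elim: (stops p) => [|y ys IH] H; first by rewrite /= eqxx.
have y0 : 0 <= y by case/andP: (H y (mem_head _ _)).
rewrite /= subrr mul0r lexx ltnS => ilt.
have [y00|yn0] := eqVneq y 0.
  by move: ilt; rewrite y00 -ltnS; apply: IH => z zy; apply: H; rewrite inE zy orbT.
by apply: (@turning_alternates true) ilt; rewrite lt_def yn0.
Qed.

Lemma travel_ge0 (p : plan) : 0 <= travel p.
Proof. by rewrite /travel /path_length; apply: sumr_ge0 => i _. Qed.

Lemma opt_length_optimal (I : instance) (p : plan) :
  optimal_offline I p -> opt_length I = travel p.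
Proof.
move=> [pI pmin]; apply/eqP; rewrite eq_le; apply/andP; split.
  apply: ge_inf; last by exists p.
  by exists (travel p) => _ [q qI <-]; exact: pmin.
by apply: lb_le_inf; [exists (travel p), p | move=> _ [q qI <-]; exact: pmin].
Qed.

End BarrierCoverage.

(* Main.v *)
(* Take r = 1/2 and L = N, so that N sensors have to fill the slots k + 1/2.
   The adversary presents K sensors at the last of the K slots they must fill,
   followed by sensors that are already in place, for as long as the robot
   does not carry sensors back to the first empty slot.  When it does so after
   reaching y, everything up to y gets walked three times, and the adversary
   starts again beyond y with a new cluster.
   - If the slots up to z >= N/2 have been handled in this way, all remaining
     sensors are put near L.  The robot has to fetch them: it walks about
     2N + z >= 5N/2, while 2N suffices.
   - If the robot reaches the end before going back to slot z < N/2, it walks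
     about 2N + z, while the plan that fills each cluster at once walks at most
     N + 2z + 2K. *)
Require Import Defs.
From mathcomp Require Import all_boot all_order all_algebra.
From mathcomp Require Import boolp classical_sets reals constructive_ereal ereal.
From mathcomp Require Import zify lra.
Set Implicit Arguments.
Unset Strict Implicit.
Unset Printing Implicit Defensive.
Import Order.TTheory GRing.Theory Num.Theory.
Local Open Scope ring_scope.

(** * Lengths of paths given by their stops *)

Section Paths.
Variable R : realType.
Implicit Types (x y a b : R) (s t : seq R).

Lemma path_length1 x : path_length [:: x] = 0.
Proof. by rewrite /path_length big_geq. Qed.

Lemma path_length_ge0 t : 0 <= path_length t.
Proof. by apply: sumr_ge0 => i _. Qed.

Lemma path_length_cat a s t :
  path_length (a :: s ++ t) = path_length (a :: s) + path_length (last a s :: t).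
Proof.
elim: s a => [|x s IH] a /=; first by rewrite path_length1 add0r.
by rewrite !path_length_cons IH addrA.
Qed.

Lemma path_length_rcons2 a s x y :
  path_length (a :: rcons (rcons s x) y) = path_length (a :: rcons s x) + `|y - x|.
Proof.
by rewrite -cats1 path_length_cat last_rcons path_length_cons path_length1 addr0.
Qed.

(** This is the triangle inequality. Lower bounds on the robot's walk are obtained by keeping only a
    few of its stops. *)
Lemma path_length_subseq a s t :
  subseq s t -> path_length (a :: s) <= path_length (a :: t).
Proof.
elim: t a s => [|y t IH] a [|x s] //=; rewrite ?path_length1 ?path_length_ge0 //.
case: eqP => [-> /IH le_st|_ /IH le_st]; first by rewrite !path_length_cons lerD2l.
rewrite (path_length_cons a y); apply: le_trans (lerD (lexx _) (le_st y)).
by rewrite !path_length_cons addrA lerD2r addrC ler_distD.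
Qed.

Lemma path_length_ascending a s :
  path <=%R a s -> path_length (a :: s) = last a s - a.
Proof.
elim: s a => [|x s IH] a /=; first by rewrite path_length1 subrr.
case/andP=> le_ax /IH; rewrite path_length_cons => ->.
by rewrite ger0_norm ?subr_ge0 // addrC subrKA.
Qed.

End Paths.

(** * How plans move sensors *)

Section Executions.
Variable R : realType.
Implicit Types (L : R) (c : config R) (p q : plan R).

Lemma exec_cat L c p q :
  exec L c (p ++ q) = obind (fun d => exec L d q) (exec L c p).
Proof. by elim: p c => //= a p IH c; case: step. Qed.

Lemma stops_cat p q : stops (p ++ q) = stops p ++ stops q.
Proof. exact: pmap_cat. Qed.

Lemma stops_before M p :
  stops (before M p) = take (find (>%R^~ M) (stops p)) (stops p).
Proof.
rewrite /before; elim: p => [|[y|i|i] p IH] //=.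
by case: ifP => //= _; congr cons.
Qed.

Lemma exec_size L c p d :
  exec L c p = Some d -> size (locations d) = size (locations c).
Proof.
elim: p c => [|a p IH] c /=; first by case=> ->.
case E: (step L c a) => [e|] // /IH ->; case: a E => [y|i|i] /=.
- by case: ifP => // _ [<-].
- case: ifP => // /eqP Ei [<-]; rewrite size_set_nth; apply/maxn_idPr.
  by rewrite ltnNge; apply/negP => /(nth_default None); rewrite Ei.
- by case: ifP => // /andP[lt_i _] [<-]; rewrite size_set_nth; apply/maxn_idPr.
Qed.

(** A sensor moves only with the robot, so the robot visits the old location and, later, the new
    one; [mem2] records this order. The case of a sensor carried from the start lets the induction
    pass a [Pick]. *)
Lemma exec_moved L c p d (i : nat) (b : R) :
  exec L c p = Some d -> nth None (locations d) i = Some b ->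
  match nth None (locations c) i with
  | Some a => a = b \/ mem2 (robot c :: stops p) a b
  | None => b \in robot c :: stops p
  end.
Proof.
elim: p c => [|a p IH] c /=; first by case=> -> ->; left.
case E: (step L c a) => [e|] // ed db; have {IH} := IH e ed db.
case: a E => [y|j|j] /=.
- case: ifP => // _ [<-] /=; case: nth => [a [->|m2]|bp]; first by left.
    right; rewrite mem2_cons; case: ifP => // _.
    by rewrite inE (mem2r m2) orbT.
  by rewrite inE bp orbT.
- case: ifP => // /eqP Ej [<-] /=; rewrite nth_set_nth /=.
  by case: eqVneq => [->|//]; rewrite Ej; right; rewrite mem2_cons eqxx.
- case: ifP => // /andP[_ /eqP Ej] [<-] /=; rewrite nth_set_nth /=.
  case: eqVneq => [->|//]; rewrite Ej => -[->|]; first exact: mem_head.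
  exact: mem2r.
Qed.

End Executions.

(** * Coverage forces sensors to be carried back *)

Section Crossing.
Variable R : realType.
Implicit Types (ps : seq R) (p : plan R).

Lemma gap_above ps (w : R) :
  exists2 e : R, 0 < e & forall x, x \in ps -> w < x -> w + e <= x.
Proof.
elim: ps => [|y ps [e e0 He]]; first by exists 1.
case: (ltP w y) => [wy|yw].
  exists (Num.min e (y - w)); first by rewrite lt_min e0 subr_gt0.
  move=> x; rewrite inE => /orP[/eqP-> _|xps wx].
    by rewrite -lerBrDl ge_min lexx orbT.
  by rewrite -lerBrDl ge_min lerBrDl He.
exists e => // x; rewrite inE => /orP[/eqP->|]; last exact: He.
by rewrite ltNge yw.
Qed.

(* The points [i (1 + h)], [i <= z], are pairwise too far apart to share a
   sensor; [h] is so small that only sensors in [0, z + 1/2] cover them. *)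
Lemma coverage_count (L : R) ps (z : nat) :
  complete_coverage L 2^-1 ps -> z%:R < L ->
  (z < count (fun y => y <= z%:R + 2^-1)%R ps)%N.
Proof.
move=> cov zL.
(* Adding [L + 2^-1] to the list gives [z + e <= L], so that the points [pt i], all below [z + e],
   lie on the barrier. *)
have [e e0 He] := gap_above (L + 2^-1 :: ps) (z%:R + 2^-1).
have eL : z%:R + 2^-1 + e <= L + 2^-1.
  by apply: He; [exact: mem_head | lra].
pose h := e / (z.+1)%:R; have h0 : 0 < h by rewrite divr_gt0.
pose pt (i : nat) : R := i%:R * (1 + h).
have pt_le i : (i <= z)%N -> pt i < z%:R + e.
  move=> iz; apply: le_lt_trans (_ : z%:R * (1 + h) < _).
    by rewrite ler_wpM2r ?ler_nat //; lra.
  rewrite mulrDr mulr1 ltrD2l /h mulrCA gtr_pMr //.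
  by rewrite ltr_pdivrMr // mul1r ltr_nat.
set qs : seq R := [seq y <- ps | y <= z%:R + 2^-1].
rewrite -size_filter -/qs.
pose f i := find (fun y => y - 2^-1 <= pt i <= y + 2^-1) qs.
have has_f i : (i <= z)%N -> has (fun y => y - 2^-1 <= pt i <= y + 2^-1) qs.
  move=> iz; have pti := pt_le _ iz.
  have pt0 : 0 <= pt i by rewrite mulr_ge0 //; lra.
  have /hasP[y yps yi] : covered_at 2^-1 ps (pt i) by apply: cov; lra.
  apply/hasP; exists y => //; rewrite mem_filter yps andbT leNgt.
  apply/negP => zy; have := He y; rewrite inE yps orbT => /(_ isT zy); lra.
rewrite -(size_iota 0 z.+1) -(size_iota 0 (size qs)) -(size_map f).
apply: uniq_leq_size.
  rewrite map_inj_in_uniq ?iota_uniq // => i j.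
  rewrite !mem_iota !add0n !ltnS => iz jz fij.
  have := nth_find 0 (has_f i iz); have := nth_find 0 (has_f j jz).
  rewrite -/(f i) -/(f j) fij; set y := nth _ _ _ => yj yi.
  have far k l : (k < l)%N -> pt k + 1 < pt l.
    move=> kl; have : (k.+1)%:R <= l%:R :> R by rewrite ler_nat.
    by rewrite -natr1 /pt; nra.
  case: (ltngtP i j) => // /far ij; exfalso; lra.
move=> _ /mapP[i iz ->]; rewrite mem_iota add0n /=.
by rewrite -has_find has_f //; move: iz; rewrite mem_iota.
Qed.

(** By [coverage_count] more than [z] sensors end in [[0, z + 1/2]]. At most [z] of them are among
    the first [z], so another one, initially at some [a >= v], has been carried back to its final
    place [b]. *)
Lemma carried_back I p (z : nat) (v : R) :
  restores I p -> radius I = 2^-1 -> z%:R < barrier I -> z%:R + 2^-1 < v ->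
  all (>=%R^~ v) (drop z (sites I)) ->
  exists s1 b s2, [/\ stops p = s1 ++ b :: s2, b <= z%:R + 2^-1
                    & exists2 a, a \in s1 & v <= a].
Proof.
move=> [c /= ex cov] r2 zL zv /allP far; rewrite r2 in cov.
have /hasP[b] : has (fun y => y <= z%:R + 2^-1) (pmap id (drop z (locations c))).
  have := coverage_count cov zL; rewrite has_count.
  rewrite -[locations c in X in X -> _](cat_take_drop z) pmap_cat count_cat => lt_z.
  rewrite -(ltn_add2l z) addn0; apply: leq_trans lt_z _; rewrite leq_add2r.
  apply: leq_trans (count_size _ _) _; rewrite size_pmap.
  by apply: leq_trans (count_size _ _) _; rewrite size_take_min geq_minl.
rewrite mem_pmap map_id => /(nthP None)[i ilt bi] bz.
rewrite nth_drop in bi; rewrite size_drop ltn_subRL in ilt.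
have zi : (z + i < size (sites I))%N.
  by rewrite (exec_size ex) size_map in ilt.
have := exec_moved ex bi; rewrite /= (nth_map 0) //.
set a := nth _ _ _.
have va : v <= a.
  by apply: far; rewrite /a -nth_drop mem_nth // size_drop ltn_subRL.
have ba : b < a := lt_le_trans (le_lt_trans bz zv) va.
(* The robot starts at 0, so it reaches the sensor at [a] only through a stop of the plan. *)
have a0 : 0 < a.
  by apply: lt_le_trans va; apply: le_lt_trans zv; rewrite addr_ge0 ?invr_ge0.
case=> [ab|]; first by rewrite ab ltxx in ba.
rewrite mem2_cons; case: eqP => [a00|_]; first by rewrite -a00 ltxx in a0.
rewrite /mem2; set s := stops p => bs.
have: s = take (index a s) s ++ drop (index a s) s by rewrite cat_take_drop.
have as_ : a \in s.
  by rewrite -index_mem; case: ltnP => // /drop_oversize sd; rewrite sd in bs.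
rewrite (drop_nth 0) ?index_mem // nth_index // in bs *.
move: bs; rewrite inE => /orP[/eqP ab|]; first by rewrite ab ltxx in ba.
case/splitPr=> t1 t2 Es.
exists (take (index a s) s ++ a :: t1), b, t2; split=> //.
  by rewrite [LHS]Es -catA.
by exists a => //; rewrite mem_cat mem_head orbT.
Qed.

End Crossing.

(** For r = 1/2 a sensor at this point covers exactly [[k, k + 1]]. *)
Definition slot (R : realType) (k : nat) : R := k%:R + 2^-1.

(** * Offline plans that gather groups of sensors and spread them over the slots *)

Section Sweeps.
Variable R : realType.
Implicit Types (L x : R) (vs : seq R) (vss : seq (seq R)) (A C : seq (option R)).
Notation slot := (@slot R).

(** Here and below [k] numbers both the first sensor of a group and the first slot it fills: sensor
    [i] always ends in slot [i]. *)
Fixpoint gather (k : nat) vs : plan R :=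
  if vs is v :: vs' then [:: Go v, Defs.Pick R k & gather k.+1 vs'] else [::].

(** Slots are filled from right to left, on the way back from the gathered sensors. *)
Fixpoint spread (k n : nat) : plan R :=
  if n is m.+1 then [:: Go (slot (k + m)), Drop R (k + m) & spread k m]
  else [::].

Fixpoint sweeps (k : nat) vss : plan R :=
  if vss is vs :: vss' then
    gather k vs ++ spread k (size vs) ++ sweeps (k + size vs) vss'
  else [::].

Lemma stops_gather k vs : stops (gather k vs) = vs.
Proof. by rewrite /stops; elim: vs k => //= v vs IH k; rewrite IH. Qed.

Lemma set_nth_size A (a b : option R) C :
  set_nth None (A ++ a :: C) (size A) b = A ++ b :: C.
Proof. by elim: A => //= a' A ->. Qed.

Lemma nth_size A (a : option R) C : nth None (A ++ a :: C) (size A) = a.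
Proof. by rewrite nth_cat ltnn subnn. Qed.

Lemma exec_gather L x A vs C :
  {in vs, forall v, 0 <= v <= L} ->
  exists y, exec L (Config x (A ++ map Some vs ++ C)) (gather (size A) vs)
    = Some (Config y (A ++ nseq (size vs) None ++ C)).
Proof.
elim: vs x A => [|v vs IH] x A vsL /=; first by exists x.
rewrite vsL ?mem_head //= nth_size eqxx set_nth_size.
have [|y] := IH v (rcons A None).
  by move=> w wvs; apply: vsL; rewrite inE wvs orbT.
by rewrite !cat_rcons size_rcons => Hy; exists y.
Qed.

Lemma exec_spread L x A n C :
  (size A + n)%:R <= L ->
  exists y, exec L (Config x (A ++ nseq n None ++ C)) (spread (size A) n)
    = Some (Config y (A ++ [seq Some (slot i) | i <- iota (size A) n] ++ C)).
Proof.
elim: n x C => [|n IH] x C nL /=; first by exists x.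
move: nL; rewrite addnS -natr1 => nL.
have n0 : 0 <= (size A + n)%:R :> R by [].
have -> : 0 <= slot (size A + n) <= L by rewrite /slot; lra.
have E (a : option R) :
    A ++ nseq n None ++ a :: C = (A ++ nseq n None) ++ a :: C by rewrite catA.
have -> : A ++ None :: nseq n None ++ C = A ++ nseq n None ++ None :: C.
  by congr (_ ++ _); elim: (n) => //= m ->.
have sA : size (A ++ nseq n (@None R)) = (size A + n)%N.
  by rewrite size_cat size_nseq.
rewrite /= E -sA nth_size eqxx set_nth_size andbT !size_cat /= -addnA.
rewrite ltn_add2l addnS ltnS leq_addr /= -catA size_nseq.

(* The last carried sensor is dropped first, so it joins the tail [C]. *)
have [|y ->] := IH (slot (size A + n)) (Some (slot (size A + n)) :: C).
  by apply: le_trans nL; rewrite lerDl.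
exists y; congr (Some (Config _ (_ ++ _))).
rewrite -[RHS]/([seq Some (slot i) | i <- iota (size A) n.+1] ++ C).
by rewrite -(addn1 n) iotaD map_cat -catA.
Qed.

Lemma exec_sweeps L x A vss :
  {in flatten vss, forall v, 0 <= v <= L} ->
  (size A + size (flatten vss))%:R <= L ->
  exists y, exec L (Config x (A ++ map Some (flatten vss))) (sweeps (size A) vss)
    = Some (Config y
        (A ++ [seq Some (slot i) | i <- iota (size A) (size (flatten vss))])).
Proof.
elim: vss x A => [|vs vss IH] x A vsL nL /=; first by exists x.
rewrite !exec_cat map_cat.
have [|y ->] := @exec_gather L x A vs (map Some (flatten vss)).
  by move=> v vvs; apply: vsL; rewrite mem_cat vvs.
rewrite /= exec_cat.
have [|w ->] := @exec_spread L y A (size vs) (map Some (flatten vss)).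
  by apply: le_trans nL; rewrite ler_nat leq_add2l size_cat leq_addr.
rewrite /= catA.
have sA : size (A ++ [seq Some (slot i) | i <- iota (size A) (size vs)]) =
  (size A + size vs)%N by rewrite size_cat size_map size_iota.
have [||u] := IH w (A ++ [seq Some (slot i) | i <- iota (size A) (size vs)]).
- by move=> v vvs; apply: vsL; rewrite mem_cat vvs orbT.
- by rewrite sA -addnA -size_cat.
rewrite sA => ->; exists u; congr (Some (Config _ _)).
by rewrite -catA -map_cat -iotaD size_cat.
Qed.

Lemma complete_coverage_slots (n : nat) : (0 < n)%N ->
  complete_coverage n%:R 2^-1 [seq slot i | i <- iota 0 n].
Proof.
move=> n0 x /andP[x0 xn]; apply/hasP.
have [xn1|xn1] := ltP x n%:R.
  have /andP[kx xk] := truncn_itv x0.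
  exists (slot (Num.truncn x)); last by rewrite /slot; rewrite -natr1 in xk; lra.
  by rewrite map_f // mem_iota add0n /= -(ltr_nat R); apply: le_lt_trans xn1.
(* At [x = n] the integer part would name a slot outside the list; the last slot covers its own
   right end. *)
exists (slot n.-1); first by rewrite map_f // mem_iota add0n /= prednK.
by rewrite /slot; move: xn xn1; rewrite -{1 2}(prednK n0) -natr1; lra.
Qed.

Lemma restores_sweeps I vss (n : nat) : (0 < n)%N ->
  barrier I = n%:R -> radius I = 2^-1 -> sites I = flatten vss ->
  size (flatten vss) = n -> {in flatten vss, forall v, 0 <= v <= n%:R} ->
  restores I (sweeps 0 vss).
Proof.
move=> n0 In Ir Is sn vsn; rewrite /restores /initial In Ir Is.
have [|y] := @exec_sweeps n%:R 0 [::] vss vsn; first by rewrite sn.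
rewrite !cat0s => /= ->; eexists; first by [].
rewrite /= sn (_ : pmap id _ = [seq slot i | i <- iota 0 n]).
  exact: complete_coverage_slots.
by elim: (iota 0 n) => //= i s ->.
Qed.

(** The first drop is at the starting point and costs nothing; [n] unit steps remain. The tail [t]
    stands for the next group. *)
Lemma path_length_spread k n t :
  path_length (slot (k + n) :: stops (spread k n.+1) ++ t)
    = n%:R + path_length (slot k :: t).
Proof.
elim: n => [|n IH].
  by rewrite /= path_length_cons addn0 subrr normr0.
rewrite -[stops _]/(slot (k + n.+1) :: stops (spread k n.+1)) cat_cons.
rewrite path_length_cons subrr normr0 add0r.
rewrite -[stops _]/(slot (k + n) :: stops (spread k n)) cat_cons.
rewrite path_length_cons; move: IH.
rewrite -[stops _]/(slot (k + n) :: stops (spread k n)) cat_cons.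
rewrite path_length_cons subrr normr0 add0r => ->.
rewrite addnS /slot -!natr1 addrA; congr (_ + _).
by rewrite addrC ler0_norm; lra.
Qed.

(** The sensors are gathered on the way to the last slot, at [n - 1/2], and the way back to the
    first slot takes [n - 1]. *)
Lemma travel_gather_spread (n : nat) vs :
  sorted <=%R vs -> {in vs, forall v, 0 <= v <= n%:R - 1} -> size vs = n ->
  travel (gather 0 vs ++ spread 0 n) <= 2 * n%:R.
Proof.
move=> svs vsn sn; rewrite travelE stops_cat stops_gather.
have path0 : path <=%R 0 vs.
  case: vs svs vsn {sn} => //= v vs svs vsn.
  by case/andP: (vsn v (mem_head _ _)) => ->.
rewrite path_length_cat path_length_ascending // subr0.
case: n vsn sn => [|n] vsn sn.
  by move/size0nil: sn => ->; rewrite /= path_length1 mulr0 addr0.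
have := path_length_spread 0 n [::].
rewrite -[stops _]/(slot (0 + n) :: stops (spread 0 n)) cats0.
rewrite !path_length_cons path_length1 subrr normr0 add0r => ->.
have /andP[l0 ln] : 0 <= last 0 vs <= n.+1%:R - 1.
  by apply: vsn; case: vs sn {svs path0} => //= v vs _; exact: mem_last.
rewrite add0n /slot -natr1 in ln *.
by rewrite ger0_norm; lra.
Qed.

(* A cluster of [b] sensors lies at the last of the [b] slots it has to fill. *)
Fixpoint chunks (k : nat) (bs : seq nat) : seq (seq R) :=
  if bs is b :: bs' then
    nseq b ((k + b)%:R - 2^-1) :: chunks (k + b) bs'
  else [::].

Definition clusters k bs : seq R := flatten (chunks k bs).

Lemma clusters_cons k b bs :
  clusters k (b :: bs) = nseq b ((k + b)%:R - 2^-1) ++ clusters (k + b) bs.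
Proof. by []. Qed.

Lemma clusters_cat k bs1 bs2 :
  clusters k (bs1 ++ bs2) = clusters k bs1 ++ clusters (k + sumn bs1) bs2.
Proof.
elim: bs1 k => [|b bs IH] k /=; first by rewrite addn0.
by rewrite !clusters_cons IH addnA catA.
Qed.

Lemma size_clusters k bs : size (clusters k bs) = sumn bs.
Proof.
by elim: bs k => //= b bs IH k; rewrite clusters_cons size_cat size_nseq IH.
Qed.

Lemma clusters_bound k bs v :
  v \in clusters k bs -> slot k <= v <= (k + sumn bs)%:R - 2^-1.
Proof.
elim: bs k => //= b bs IH k; rewrite clusters_cons mem_cat mem_nseq addnA.
have le_sum : (k + b)%:R <= (k + b + sumn bs)%:R :> R by rewrite ler_nat leq_addr.
case/orP=> [/andP[b0 /eqP->]|/IH]; last first.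
  by rewrite /slot !natrD => /andP[]; have : 0 <= b%:R :> R by []; lra.
have : 1 <= b%:R :> R by rewrite ler1n.
by move: le_sum; rewrite /slot !natrD; lra.
Qed.

Lemma sorted_clusters k bs : pairwise <=%R (clusters k bs).
Proof.
elim: bs k => //= b bs IH k; rewrite clusters_cons pairwise_cat IH andbT.
apply/andP; split.
  apply/allrelP => v w /nseqP[-> _] /clusters_bound /andP[+ _].
  by rewrite /slot; lra.
by elim: b (_ - _) => //= b IHb v; rewrite IHb all_nseq lexx orbT.
Qed.

(** Compared with a direct walk to the last slot, a cluster of [b] sensors costs [b - 1] backwards
    and [b - 1] forwards again. The lone last sensor moves right by 1/2, without any return. *)
Lemma path_length_clusters k bs x : all (leq 1) bs -> x <= k%:R ->
  path_length
    (x :: stops (sweeps k (chunks k bs ++ [:: [:: (k + sumn bs)%:R]])))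
  = slot (k + sumn bs) - x + 2 * ((sumn bs)%:R - (size bs)%:R).
Proof.
elim: bs k x => [|b bs IH] k x /=.
  rewrite !addn0 => _ xk; rewrite /stops /= !path_length_cons path_length1.
  by rewrite /slot !addr0 !ger0_norm; lra.
case/andP=> b0 bs0 xk; rewrite size_nseq !stops_cat stops_gather.
case: b b0 => // b _.
have k0 : 0 <= b%:R :> R by [].
have end_nseq : last x (nseq b.+1 ((k + b.+1)%:R - 2^-1 : R)) = slot (k + b).
  transitivity ((k + b.+1)%:R - 2^-1 : R).
    by elim: b {k0} x xk (_ - _) => //= b IHb x _ v; apply: (IHb v).
  by rewrite /slot addnS -natr1; lra.
rewrite path_length_cat end_nseq path_length_spread addnA IH //; last first.
  by rewrite /slot natrD -(natr1 b); lra.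
rewrite path_length_ascending; last first.
  rewrite /= natrD -(natr1 b); apply/andP; split; first by lra.
  by elim: (b) (_ - _) => //= m IHm v; rewrite lexx IHm.
by rewrite end_nseq /slot -(natr1 (size bs)) !natrD -(natr1 b); lra.
Qed.

End Sweeps.

(** * The instances of the adversary and offline plans for them *)

Section Adversary.
Variable R : realType.
Implicit Types (I : instance R) (A : instance R -> plan R) (p : plan R).

Lemma seq_has_max (s : seq R) (a : R) : a \in s ->
  exists2 m, m \in s & {in s, forall x, x <= m}.
Proof.
elim: s a => // x s IH a _.
case: s IH => [_|y s /(_ y (mem_head _ _))[m ms mP]].
  by exists x; [exact: mem_head | move=> z; rewrite inE => /eqP->].
case: (leP x m) => xm.
  by exists m; [rewrite inE ms orbT | move=> z; rewrite inE => /orP[/eqP->|/mP]].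
exists x; first exact: mem_head.
move=> z; rewrite inE => /orP[/eqP->//|/mP zm].
exact: le_trans zm (ltW xm).
Qed.

(** The plan [p] bounds the optimum from above; the lower bound [v] makes the infimum positive, so
    that one may divide by it. *)
Lemma le_competitive_ratio A I p (rho opt v : R) :
  admissible I -> restores I p -> travel p <= opt ->
  (forall q, restores I q -> v <= travel q) -> 0 < v ->
  rho * opt <= travel (A I) -> (rho%:E <= competitive_ratio A)%E.
Proof.
move=> adm rp le_p low v0 le_A.
have opt_le : opt_length I <= opt.
  apply: le_trans le_p; apply: ge_inf; last by exists p.
  by exists 0 => _ [q _ <-]; exact: travel_ge0.
have opt_gt0 : 0 < opt_length I.
  apply: lt_le_trans v0 _; apply: lb_le_inf; first by exists (travel p), p.
  by move=> _ [q /low + <-].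
apply: le_trans (ereal_sup_ubound _); last by exists I.
rewrite lee_fin ler_pdivlMr //.
(* A large [eps] makes [rho] negative; then nonnegativity of the travel suffices. *)
have [rho0|rho0] := leP 0 rho; first by apply: le_trans le_A; rewrite ler_wpM2l.
by apply: le_trans (travel_ge0 _); rewrite pmulr_lle0 // ltW.
Qed.

(** Supplies the lower bound [v] of [le_competitive_ratio]. *)
Lemma carried_back_travel I p (z : nat) (v : R) :
  restores I p -> radius I = 2^-1 -> z%:R < barrier I -> z%:R + 2^-1 < v ->
  all (>=%R^~ v) (drop z (sites I)) -> v <= travel p.
Proof.
move=> rp Ir zI zv far.
have [s1 [b [s2 [Es _ [a as1 va]]]]] := carried_back rp Ir zI zv far.
apply: le_trans va _; rewrite travelE Es.
apply: le_trans (_ : path_length [:: 0; a] <= _).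
  by rewrite path_length_cons path_length1 addr0 subr0 ler_norm.
by apply: path_length_subseq; rewrite sub1seq mem_cat as1.
Qed.

(* At N - 1 the remaining sensors leave the endpoint N uncovered. *)
Definition hard (N : nat) (bs : seq nat) : instance R :=
  Instance N%:R 2^-1 (clusters R 0 bs ++ nseq (N - sumn bs) (N%:R - 1)).

Lemma size_hard N bs : (sumn bs <= N)%N -> size (sites (hard N bs)) = N.
Proof. by move=> le_N; rewrite size_cat size_clusters size_nseq subnKC. Qed.

Lemma hard_sites N bs x : (sumn bs < N)%N ->
  x \in sites (hard N bs) -> 0 <= x <= N%:R - 1.
Proof.
rewrite -(ler_nat R) -natr1 mem_cat => sN.
have z0 : 0 <= (sumn bs)%:R :> R by [].
case/orP=> [/clusters_bound|/nseqP[-> _]]; last by lra.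
by rewrite /slot add0n; lra.
Qed.

Lemma sorted_hard N bs : (sumn bs < N)%N -> sorted <=%R (sites (hard N bs)).
Proof.
move=> sN; rewrite (sorted_pairwise le_trans) pairwise_cat sorted_clusters /=.
apply/andP; split; last by elim: (_ - _)%N => //= n ->; rewrite all_nseq lexx orbT.
apply/allrelP => v w vs /nseqP[-> _].
have: v \in sites (hard N bs) by rewrite mem_cat vs.
by case/(hard_sites sN)/andP.
Qed.

Lemma hard_admissible N bs : (sumn bs < N)%N -> admissible (hard N bs).
Proof.
move=> sN; have N0 : (0 < N)%N by case: (N) sN.
have N0r : 0 < N%:R :> R by rewrite ltr0n.
split=> //=.
- exact: sorted_hard.
- by move=> x /(hard_sites sN); lra.
- by rewrite -/(sites (hard N bs)) size_hard ?(ltnW sN) // mulfV ?mul1r.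
- by apply/hasPn => x /(hard_sites sN); lra.
Qed.

(** The sensors of [bs2] lie at slot [sumn bs1] or beyond and the remaining ones at [N - 1], all to
    the right of [y]. Hence a robot that has stayed in [[0, y]] cannot tell how the instance
    continues. *)
Lemma seen_hard N bs1 bs2 y :
  (sumn bs1)%:R - 2^-1 <= y -> y < (sumn bs1)%:R + 2^-1 -> y < N%:R - 1 ->
  seen y (hard N (bs1 ++ bs2)) = clusters R 0 bs1.
Proof.
move=> ly yu yN; rewrite /seen /= clusters_cat -catA !filter_cat.
rewrite (all_filterP _); last first.
  by apply/allP => x /clusters_bound/andP[_]; rewrite add0n => /le_trans; apply.
rewrite (_ : [seq _ <- clusters _ _ _ | _] = [::]); last first.
  apply/eqP; rewrite -[_ == _]negbK -has_filter -all_predC.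
  by apply/allP => x /clusters_bound/andP[]; rewrite /slot add0n /=; lra.
rewrite (_ : [seq _ <- nseq _ _ | _] = [::]) ?cats0 //.
apply/eqP; rewrite -[_ == _]negbK -has_filter -all_predC.
by apply/allP => x /nseqP[-> _] /=; lra.
Qed.

Lemma restores_hard_return N bs : (sumn bs < N)%N ->
  exists2 p, restores (hard N bs) p & travel p <= 2 * N%:R.
Proof.
move=> sN; have N0 : (0 < N)%N by case: (N) sN.
exists (sweeps 0 [:: sites (hard N bs)]).
  apply: (@restores_sweeps _ _ _ N); rewrite //= ?cats0 //.
    by rewrite -/(sites (hard N bs)) size_hard // ltnW.
  by move=> v; rewrite -/(sites (hard N bs)) => /(hard_sites sN); lra.
rewrite [sweeps _ _]/= cats0 size_hard ?(ltnW sN) //.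
apply: travel_gather_spread; first exact: sorted_hard.
  by move=> v /(hard_sites sN).
by rewrite size_hard // ltnW.
Qed.

Lemma restores_hard_clusters N bs : (sumn bs).+1 = N -> all (leq 1) bs ->
  exists2 p, restores (hard N bs) p
    & travel p <= N%:R + 2 * ((sumn bs)%:R - (size bs)%:R).
Proof.
move=> sN bs1; have sN' : (sumn bs < N)%N by rewrite -sN.
have N0 : (0 < N)%N by case: (N) sN.
have E : flatten (chunks R 0 bs ++ [:: [:: (0 + sumn bs)%:R]]) =
         sites (hard N bs).
  by rewrite flatten_cat /= -sN subSnn /= -natr1 addrK.
exists (sweeps 0 (chunks R 0 bs ++ [:: [:: (0 + sumn bs)%:R]])).
  apply: (@restores_sweeps _ _ _ N); rewrite ?E //.
    by rewrite size_hard // ltnW.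
  by move=> v /(hard_sites sN'); lra.
by rewrite travelE path_length_clusters // /slot add0n -sN -(natr1 (sumn bs)); lra.
Qed.

End Adversary.

(** * The game against an online algorithm *)

Section Online.
Variables (R : realType) (A : instance R -> plan R) (N K : nat).
Hypotheses (onA : online_algorithm A) (K_gt1 : (1 < K)%N).
Implicit Types (bs : seq nat) (y w : R).
Notation hard := (@hard R N).

(* The robot has first reached [y] only after walking nearly three times over
   [0, y]: at most twice a unit is lost for every [K] slots. *)
Record cornered bs y : Prop := Cornered {
  cornered_ge0 : 0 <= y;
  cornered_ltN : y < N%:R - 3 / 2;
  cornered_low : (sumn bs)%:R - 2^-1 <= y;
  cornered_up : y < (sumn bs)%:R + 2^-1;
  cornered_pos : all (leq 1) bs;
  cornered_cost : forall I w, admissible I ->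
    barrier I = N%:R -> radius I = 2^-1 -> seen y I = clusters R 0 bs ->
    y <= w ->
    3 * y - 2 * (sumn bs)%:R / K%:R + (w - y)
      <= path_length (0 :: rcons (stops (before y (A I))) w)
}.

Lemma cornered_start : (1 < N)%N -> cornered [::] 0.
Proof.
rewrite -(ler_nat R) => N1; split=> //=; try lra.
move=> I w _ _ _ _ w0; apply: le_trans (_ : path_length [:: 0; w] <= _).
  by rewrite path_length_cons path_length1 subr0 !mulr0 mul0r ger0_norm; lra.
by apply: path_length_subseq; rewrite sub1seq mem_rcons mem_head.
Qed.

Lemma cornered_lt bs y : cornered bs y -> (sumn bs < N)%N.
Proof.
by move=> st; rewrite -(ltr_nat R); have := cornered_low st;
   have := cornered_ltN st; lra.
Qed.

(** The stops made before leaving [[0, y]], then [m], then [b] form a subsequence of the walk up to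
    [b], since [m > y] can only come after these stops. The part up to [m] is [cornered_cost] with
    [w = m]. *)
Lemma detour_cost bs y I (s1 s2 : seq R) (b m : R) : cornered bs y ->
  admissible I -> barrier I = N%:R -> radius I = 2^-1 ->
  seen y I = clusters R 0 bs ->
  stops (A I) = s1 ++ b :: s2 -> m \in s1 -> y < m ->
  3 * y - 2 * (sumn bs)%:R / K%:R + (m - y) + `|b - m|
    <= path_length (0 :: rcons s1 b).
Proof.
move=> st adm IN Ir Is Es ms ym.
have := cornered_cost st adm IN Ir Is (ltW ym).
rewrite stops_before Es; set j := find _ _.
have s1j : (j < size s1)%N.
  have hasm : has (>%R^~ y) s1 by apply/hasP; exists m.
  by rewrite /j find_cat hasm -has_find.
rewrite takel_cat ?(ltnW s1j) // => cost.
apply: le_trans (_ : path_length (0 :: rcons (rcons (take j s1) m) b) <= _).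
  by rewrite path_length_rcons2 lerD2r.
apply: path_length_subseq; rewrite -!cats1 subseq_cat2r.
rewrite -[X in subseq _ X](cat_take_drop j) subseq_cat2l sub1seq.
move: ms; rewrite -[s1 in m \in s1](cat_take_drop j) mem_cat => /orP[|//].
move=> /(nthP 0)[i]; rewrite size_take_min ltn_min => /andP[ij i1].
rewrite nth_take // => im.
by have := before_find 0 ij; rewrite nth_cat i1 im /= ym.
Qed.

(** Up to the loss term, [detour_cost] gives [2 y + 2 m - b]. With [z = sumn bs], inserting
    [y >= z - 1/2], [m >= N - 3/2] and [b <= z + 1/2] yields [2 N + z - 9/2]. *)
Lemma endgame_travel bs y I (s1 s2 : seq R) (b m : R) : cornered bs y ->
  admissible I -> barrier I = N%:R -> radius I = 2^-1 ->
  seen y I = clusters R 0 bs ->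
  stops (A I) = s1 ++ b :: s2 -> m \in s1 ->
  N%:R - 3 / 2 <= m -> b <= (sumn bs)%:R + 2^-1 ->
  2 * N%:R + (sumn bs)%:R - 2 * (sumn bs)%:R / K%:R - 5 <= travel (A I).
Proof.
move=> st adm IN Ir Is Es ms mN bz.
have yN := cornered_ltN st; have ly := cornered_low st.
have ym := lt_le_trans yN mN.
have cost := detour_cost st adm IN Ir Is Es ms ym.
rewrite travelE Es -cat_rcons path_length_cat.
have := path_length_ge0 (last 0 (rcons s1 b) :: s2).
have : m - b <= `|b - m| by rewrite distrC ler_norm.
by clear -cost ly mN bz; lra.
Qed.

(** The new [y] is [m], the farthest point reached before the return to [b]. Walking to [m], back to
    [b] and up to [w >= m] costs at least [3 m + (w - m) + 2 (y - b)], minus the old loss, and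
    [2 (y - b) >= -2]. *)
Lemma cornered_next bs y (s1 s2 : seq R) (a b m : R) n :
  cornered bs y -> (sumn bs + K + n).+1 = N ->
  let J := hard (bs ++ K :: nseq n 1%N) in
  stops (A J) = s1 ++ b :: s2 -> a \in s1 ->
  (sumn bs + K)%:R - 2^-1 <= a -> b <= (sumn bs)%:R + 2^-1 ->
  m \in s1 -> {in s1, forall x, x <= m} -> m < N%:R - 3 / 2 ->
  exists bs' y', cornered bs' y' /\ (sumn bs < sumn bs')%N.
Proof.
move=> st sN J Es as1 va bz ms max_m mN.
have y0 := cornered_ge0 st; have ly := cornered_low st.
have uy := cornered_up st; have am := max_m _ as1.
have K1 : 1 < K%:R :> R by rewrite ltr1n.
rewrite natrD in va.
have ym : y < m by lra.
have m2 : 0 <= m + 2^-1 by lra.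
(* Rounding [m] to the nearest integer [z'] counts the slots whose sensors have been shown: slot
   [z' - 1] is at most [m] and slot [z'] is beyond it. *)
have := truncn_itv m2; set z' := Num.truncn _ => /andP[z'm mz'].
rewrite -(natr1 z') in mz'.
have zz' : (sumn bs + K <= z')%N.
  by rewrite -ltnS -(ltr_nat R) -(natr1 z') natrD; lra.
have z'N : (z' <= sumn bs + K + n)%N.
  by rewrite -ltnS sN -(ltr_nat R); lra.
have sumJ : sumn (bs ++ K :: nseq n 1%N) = (sumn bs + K + n)%N.
  by rewrite sumn_cat /= sumn_nseq mul1n addnA.
have admJ : admissible J by apply: hard_admissible; rewrite sumJ -sN.
pose i := (z' - (sumn bs + K))%N.
have z'E : (sumn bs + K + i)%N = z' by rewrite subnKC.
have in_ : (i <= n)%N by rewrite -(leq_add2l (sumn bs + K)) z'E.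
have splitJ :
    bs ++ K :: nseq n 1%N = (bs ++ K :: nseq i 1%N) ++ nseq (n - i) 1%N.
  by rewrite -catA /= -nseqD subnKC.
have sum' : sumn (bs ++ K :: nseq i 1%N) = z'.
  by rewrite sumn_cat /= sumn_nseq mul1n addnA.
have seenJ : seen m J = clusters R 0 (bs ++ K :: nseq i 1%N).
  by rewrite /J splitJ seen_hard // ?sum'; lra.
have seenJy : seen y J = clusters R 0 bs.
  by rewrite seen_hard //; have := cornered_ltN st; lra.
exists (bs ++ K :: nseq i 1%N), m; rewrite sum'; split; last first.
  by apply: leq_trans zz'; rewrite -addn1 leq_add2l ltnW.
split; rewrite ?sum' //.
- by lra.
- by lra.
- by lra.
- rewrite all_cat (cornered_pos st) /= (ltnW K_gt1) /=.
  by apply/allP => x /nseqP[->].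
move=> I w admI IN Ir Is mw.
(* On [J] the robot stays in [[0, m]] up to and including [b], so it makes the same return on every
   [I] that agrees with [J] there. *)
have [-> _] := online_causal onA admI admJ IN Ir (le_trans y0 (ltW ym))
  (etrans Is (esym seenJ)).
have cost := detour_cost st admJ erefl erefl seenJy Es ms ym.
rewrite stops_before Es find_cat.
have -> : has (>%R^~ m) s1 = false.
  by apply/hasPn => x /max_m; rewrite -leNgt.
have -> /= : find (>%R^~ m) (b :: s2) = (find (>%R^~ m) s2).+1.
  by rewrite /= ifN // -leNgt; lra.
rewrite take_cat ltnNge leq_addr /= addKn /= -cat_rcons.
apply: le_trans (_ : path_length (0 :: rcons (rcons s1 b) w) <= _); last first.
  apply: path_length_subseq; rewrite -!cats1 -!catA.
  by rewrite subseq_cat2l /= eqxx suffix_subseq.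
rewrite path_length_rcons2.
have lbm : m - b <= `|b - m| by rewrite distrC ler_norm.
have lwb : w - b <= `|w - b| by rewrite ler_norm.
(* The [K] or more new slots pay for the 2 units lost in this round. *)
have Kz : 2 * (sumn bs)%:R / K%:R + 2 <= 2 * z'%:R / K%:R :> R.
  have K0 : 0 < K%:R :> R by lra.
  rewrite ler_pdivlMr // mulrDl divfK ?gt_eqF //.
  have : (sumn bs + K)%:R <= z'%:R :> R by rewrite ler_nat.
  by rewrite natrD; lra.
by clear -cost lbm lwb Kz ly bz; lra.
Qed.

Lemma drop_hard bs1 bs2 :
  drop (sumn bs1) (sites (hard (bs1 ++ bs2)))
    = clusters R (sumn bs1) bs2 ++ nseq (N - sumn (bs1 ++ bs2)) (N%:R - 1).
Proof. by rewrite /= clusters_cat -catA drop_size_cat ?size_clusters. Qed.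

(** Induction on the number of slots left, which drops with each use of [cornered_next]. The first
    hypothesis bounds the accumulated loss by [eps * sumn bs]; the second absorbs the additive
    terms. *)
Lemma cornered_ratio (eps : R) (n : nat) bs y :
  2 <= eps * K%:R -> 5 + 5 / 2 * K%:R <= eps * N%:R -> (2 * K + 2 <= N)%N ->
  (N - sumn bs <= n)%N -> cornered bs y ->
  ((5 / 4 - eps)%:E <= competitive_ratio A)%E.
Proof.
move=> epsK epsN KN; elim: n bs y => [|n IH] bs y nN st.
  by move: nN; rewrite leqn0 subn_eq0 leqNgt (cornered_lt st).
have zN := cornered_lt st.
have K1 : 2 <= K%:R :> R by rewrite ler_nat.
have z0 : 0 <= (sumn bs)%:R :> R by [].
have zNr : (sumn bs)%:R <= N%:R :> R by rewrite ler_nat ltnW.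
have eps0 : 0 < eps.
  have : 0 < eps * K%:R by lra.
  by rewrite pmulr_lgt0 //; lra.
have loss : 2 * (sumn bs)%:R / K%:R <= eps * (sumn bs)%:R.
  by rewrite ler_pdivrMr; [rewrite mulrAC ler_wpM2r | lra].
have KNr : 2 * K%:R + 2 <= N%:R :> R by rewrite -natrM -natrD ler_nat.
have ly := cornered_low st; have yN := cornered_ltN st.
(* Both bounds balance at [z = N / 2]: [5/4 * 2 N <= 2 N + z] means [N <= 2 z], and
   [5/4 * (N + 2 z) <= 2 N + z] means [2 z <= N]. *)
have [Nz|Nz] := leqP N (2 * sumn bs).
  have Nzr : N%:R <= 2 * (sumn bs)%:R :> R by rewrite -natrM ler_nat.
  have adm : admissible (hard bs) by exact: hard_admissible.
  have [p rp le_p] := restores_hard_return R zN.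
  have far : all (>=%R^~ (N%:R - 1)) (drop (sumn bs) (sites (hard bs))).
    have := drop_hard bs [::]; rewrite cats0 => ->.
    by apply/allP => x /nseqP[-> _] /=.
  have z1 : (sumn bs)%:R + 2^-1 < N%:R - 1 :> R.
    have : (sumn bs).+2%:R <= N%:R :> R.
      by rewrite ler_nat -(ltr_nat R) -(natr1 (sumn bs)); lra.
    by rewrite -(natr1 (sumn bs).+1) -(natr1 (sumn bs)); lra.
  have zb : (sumn bs)%:R < barrier (hard bs) by rewrite ltr_nat.
  apply: (le_competitive_ratio adm rp le_p (v := N%:R - 1)); last 2 first.
  - lra.
  - have [s1 [b [s2 [Es bz [a as1 va]]]]] :=
      carried_back (online_restores onA adm) erefl zb z1 far.
    have seen_bs : seen y (hard bs) = clusters R 0 bs.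
      by rewrite -[bs in hard bs]cats0 seen_hard ?(cornered_up st) //; lra.
    have := endgame_travel st adm erefl erefl seen_bs Es as1 _ bz.
    have : eps * (sumn bs)%:R <= eps * N%:R by rewrite ler_wpM2l // ltW.
    lra.
  by move=> q rq; apply: carried_back_travel rq _ zb z1 far.
have Nzr : 2 * (sumn bs)%:R <= N%:R :> R by rewrite -natrM ler_nat ltnW.
(* The cluster of [K] and [k] sensors in place leave exactly one sensor, at [N - 1]. *)
pose k := (N - (sumn bs + K).+1)%N.
have sN : (sumn bs + K + k).+1 = N.
  by rewrite -addSn subnKC //; move: Nz KN; clear; lia.
pose bs' := bs ++ K :: nseq k 1%N.
have sum' : sumn bs' = (sumn bs + K + k)%N.
  by rewrite sumn_cat /= sumn_nseq mul1n addnA.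
have pos' : all (leq 1) bs'.
  rewrite all_cat (cornered_pos st) /= (ltnW K_gt1) /=.
  by apply/allP => x /nseqP[->].
have zN' : (sumn bs' < N)%N by rewrite sum' -sN.
have adm : admissible (hard bs') by exact: hard_admissible.
have [p rp le_p] : exists2 p, restores (hard bs') p
    & travel p <= N%:R + 2 * (sumn bs)%:R + 2 * K%:R.
  have [|p rp le_p] := @restores_hard_clusters R N bs' _ pos'.
    by rewrite sum' sN.
  exists p => //; apply: le_trans le_p _; rewrite sum' size_cat /= size_nseq.
  have : 0 <= (size bs)%:R :> R by [].
  by rewrite !natrD -(natr1 k); lra.
pose v : R := (sumn bs + K)%:R - 2^-1.
have far : all (>=%R^~ v) (drop (sumn bs) (sites (hard bs'))).
  rewrite drop_hard; apply/allP => x; rewrite mem_cat clusters_cons mem_cat.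
  have vN : (sumn bs + K)%:R + 1 <= N%:R :> R.
    by rewrite natr1 ler_nat -sN ltnS leq_addr.
  by case/orP=> [/orP[/nseqP[-> _]|/clusters_bound/andP[+ _]]|/nseqP[-> _]];
     rewrite /= /v /slot; lra.
have z1 : (sumn bs)%:R + 2^-1 < v.
  by rewrite /v natrD; lra.
have zb : (sumn bs)%:R < barrier (hard bs') by rewrite ltr_nat.
have [s1 [b [s2 [Es bz [a as1 va]]]]] :=
  carried_back (online_restores onA adm) erefl zb z1 far.
have [m ms max_m] := seq_has_max as1.
(* If the robot turns back before [N - 3/2], it has not seen the sensor at [N - 1], and the
   adversary can still change the continuation. *)
have [mN|mN] := ltP m (N%:R - 3 / 2).
  have [bs1 [y1 [st1 lt1]]] :=
    cornered_next st sN Es as1 va bz ms max_m mN.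
  apply: (IH _ _ _ st1); rewrite -ltnS; apply: leq_trans nN.
  exact: ltn_sub2l zN lt1.
apply: (le_competitive_ratio adm rp le_p (v := v)); last 2 first.
- by lra.
- have seen_bs : seen y (hard bs') = clusters R 0 bs.
    by rewrite seen_hard ?(cornered_up st) //; lra.
  have := endgame_travel st adm erefl erefl seen_bs Es ms mN bz.
  have : 0 <= eps * (sumn bs)%:R by rewrite mulr_ge0 // ltW.
  have : 0 <= eps * K%:R by rewrite mulr_ge0 // ltW.
  lra.
by move=> q rq; apply: carried_back_travel rq _ zb z1 far.
Qed.

End Online.

Theorem theorem3 (R : realType) (A : instance R -> plan R) (eps : R) :
  online_algorithm A -> 0 < eps ->
  ((5 / 4 - eps)%:E <= competitive_ratio A)%E.
Proof.
move=> onA eps0.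
(* [K] makes the loss of 2 per [K] slots at most [eps] per slot. The summand [2 * K + 2] of [N]
   leaves room for a new cluster as long as fewer than [N / 2] slots are handled. *)
pose K := (Num.truncn (2 / eps)).+2.
pose N := ((Num.truncn ((5 + 5 / 2 * K%:R) / eps)).+1 + (2 * K + 2))%N.
have epsK : 2 <= eps * K%:R.
  rewrite (mulrC eps) -ler_pdivrMr // ltW //; apply: lt_trans (truncnS_gt _) _.
  by rewrite ltr_nat.
have epsN : 5 + 5 / 2 * K%:R <= eps * N%:R.
  rewrite (mulrC eps) -ler_pdivrMr // ltW //; apply: lt_le_trans (truncnS_gt _) _.
  by rewrite ler_nat leq_addr.
have K_gt1 : (1 < K)%N by [].
have N_gt1 : (1 < N)%N by rewrite /N; lia.
apply: (cornered_ratio onA K_gt1 epsK epsN _ (leqnn _)).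
  exact: leq_addl.
exact: cornered_start N_gt1.
Qed.
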